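(* Let $\mathbf{X}$ and $\mathbf{Y}$ be Euclidean spaces, let $Q\subset\mathbf{Y}$ be a nonempty closed set, let $F\colon\mathbf{X}\to\mathbf{Y}$, and let $\bar x\in\mathbf{X}$. Suppose that $F$ is continuously differentiable around $\bar x$ with one-to-one derivative $\nabla F(\bar x)$, that $F(\bar x)\in Q$, and that there exists an angle $\alpha>0$ such that whenever two vectors $x,x'\in\mathbf{X}$ near $\bar x$ satisfy \[ \nabla F(x')^*\big(y-F(x')\big)=0\quad\text{and}\quad F(x)\neq y\neq F(x')\quad\text{for some } y\in P_Q\big(F(x)\big), \] then the angle between the vectors $F(x)-y$ and $F(x')-y$ is at least $\alpha$. Consider the linearized alternating projections method: given the current iterate $x$, while $F(x)\notin Q$, choose $y\in P_Q(F(x))$, choose $s\in\mathbf{X}$ minimizing $|F(x)+\nabla F(x)s-y|$, and set $x\leftarrow x+s$. Then, starting from any point $x\in\mathbf{X}$ sufficiently close to $\bar x$, this method converges linearly to a point in the solution set $F^{-1}(Q)$.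
   Context: $P_Q(v)$ denotes the set of nearest points of $Q$ to $v$; ${}^*$ denotes the adjoint of a linear map. A sequence $(x^k)$ converges linearly to $\hat x$ if there exist constants $c\in(0,1)$ and $\rho>0$ with $|x^k-\hat x|<\rho c^k$ for all $k$. *)

(* Defs.v *)
From HB Require Import structures.
From mathcomp Require Import all_boot all_order all_algebra.
From mathcomp Require Import all_classical all_reals all_analysis.
Set Implicit Arguments. Unset Strict Implicit. Unset Printing Implicit Defensive.
Import Order.TTheory GRing.Theory Num.Theory.
Import numFieldNormedType.Exports.
Local Open Scope classical_set_scope.
Local Open Scope ring_scope.

Definition dotv {R : realType} {n : nat} (u v : 'rV[R]_n) : R := (u *m v^T) 0 0.
Definition enorm {R : realType} {n : nat} (u : 'rV[R]_n) : R := Num.sqrt (dotv u u).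

Definition angle {R : realType} {n : nat} (u v : 'rV[R]_n) : R :=
  acos (dotv u v / (enorm u * enorm v)).

Definition proj_set {R : realType} {m : nat} (Q : set 'rV[R]_m) (v : 'rV[R]_m)
  : set 'rV[R]_m :=
  [set q | Q q /\ forall q', Q q' -> enorm (v - q) <= enorm (v - q')].

(* One step x -> x' of the linearized alternating projections method:
   if F x is in Q the method has stopped (the iterate stays put); otherwise
   x' = x + s with y in P_Q(F x) and s minimizing |F x + DF(x) s - y|. *)
Definition lap_step {R : realType} {n m : nat} (F : 'rV[R]_n -> 'rV[R]_m)
  (Q : set 'rV[R]_m) (x x' : 'rV[R]_n) : Prop :=
  (Q (F x) -> x' = x) /\
  (~ Q (F x) -> exists y, proj_set Q (F x) y /\
     exists s : 'rV[R]_n, x' = x + s /\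
       forall s' : 'rV[R]_n,
         enorm (F x + 'd F x s - y) <= enorm (F x + 'd F x s' - y)).

Definition lin_conv {R : realType} {n : nat} (xs : nat -> 'rV[R]_n) (xh : 'rV[R]_n) :=
  exists c rho : R, 0 < c < 1 /\ 0 < rho /\
    forall k, enorm (xs k - xh) < rho * c ^+ k.

(* Main.v *)
(** Near [xbar] the map [F] is an immersion: uniformly in [u], [v],
    [|F u - F v - DF(v)(u - v)| <= eps |u - v|] and [k |u - v| <= |F u - F v|].
    Let [y] be a projection of [F x] on [Q], and let [x'] minimize [|F x' - y|]
    over a small closed ball.  The minimizer is interior, hence critical:
    [F x' - y] is orthogonal to the range of [DF(x')], so that
    [<F x - y, F x' - y>] is [|F x' - y|^2] up to [O(eps) |F x - y| |F x' - y|].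
    The angle condition then gives
    [|F x' - y| <= (cos alpha + O(eps)) |F x - y|].  Since [x' - x] competes
    with the linearized step [s], also
    [|F(x + s) - y| <= |F x' - y| + O(eps) |F x - y|]: the distance of [F x] to
    [Q] contracts by a factor less than [1], while [|s| <= (2/k) |F x - y|].
    Hence the iterates form a geometric Cauchy sequence. *)

Require Import Defs.
From HB Require Import structures.
From mathcomp Require Import all_boot all_order all_algebra.
From mathcomp Require Import all_classical all_reals all_analysis.
From mathcomp Require Import ring lra.
Set Implicit Arguments. Unset Strict Implicit. Unset Printing Implicit Defensive.
Import Order.TTheory GRing.Theory Num.Theory.
Import numFieldNormedType.Exports.
Local Open Scope classical_set_scope.
Local Open Scope ring_scope.

(** * Euclidean inner product and norm on row vectors *)

Section EuclideanNorm.
Context {R : realType}.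
Implicit Type n : nat.

Lemma dotvE n (u v : 'rV[R]_n) : dotv u v = \sum_i u 0 i * v 0 i.
Proof. by rewrite /dotv mxE; apply: eq_bigr => i _; rewrite mxE. Qed.

Lemma dotvC n (u v : 'rV[R]_n) : dotv u v = dotv v u.
Proof. by rewrite !dotvE; apply: eq_bigr => i _; rewrite mulrC. Qed.

Lemma dotvDl n (u v w : 'rV[R]_n) : dotv (u + v) w = dotv u w + dotv v w.
Proof. by rewrite /dotv mulmxDl mxE. Qed.

Lemma dotvZl n (a : R) (u w : 'rV[R]_n) : dotv (a *: u) w = a * dotv u w.
Proof. by rewrite /dotv -scalemxAl mxE. Qed.

Lemma dotvNl n (u w : 'rV[R]_n) : dotv (- u) w = - dotv u w.
Proof. by rewrite -scaleN1r dotvZl mulN1r. Qed.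

Lemma dotvDr n (u v w : 'rV[R]_n) : dotv w (u + v) = dotv w u + dotv w v.
Proof. by rewrite dotvC dotvDl !(dotvC w). Qed.

Lemma dotvZr n (a : R) (u w : 'rV[R]_n) : dotv w (a *: u) = a * dotv w u.
Proof. by rewrite dotvC dotvZl (dotvC w). Qed.

Lemma dotvNr n (u w : 'rV[R]_n) : dotv w (- u) = - dotv w u.
Proof. by rewrite dotvC dotvNl (dotvC w). Qed.

Lemma dotv_ge0 n (u : 'rV[R]_n) : 0 <= dotv u u.
Proof. by rewrite dotvE sumr_ge0 // => i _; rewrite -expr2 sqr_ge0. Qed.

Lemma enorm_ge0 n (u : 'rV[R]_n) : 0 <= enorm u.
Proof. exact: sqrtr_ge0. Qed.

Lemma sqr_enorm n (u : 'rV[R]_n) : enorm u ^+ 2 = dotv u u.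
Proof. exact/sqr_sqrtr/dotv_ge0. Qed.

Lemma dotv_eq0 n (u : 'rV[R]_n) : dotv u u = 0 -> u = 0.
Proof.
rewrite dotvE => /eqP; rewrite psumr_eq0; last by move=> i _; rewrite -expr2 sqr_ge0.
move/allP => h; apply/rowP => i; rewrite mxE.
by have := h i (mem_index_enum i); rewrite /= -expr2 sqrf_eq0 => /eqP.
Qed.

Lemma enorm0 n : enorm (0 : 'rV[R]_n) = 0.
Proof. by rewrite /enorm /dotv mul0mx mxE sqrtr0. Qed.

Lemma enorm_eq0 n (u : 'rV[R]_n) : enorm u = 0 -> u = 0.
Proof. by move=> u0; apply: dotv_eq0; rewrite -sqr_enorm u0 expr0n. Qed.

Lemma enorm_gt0 n (u : 'rV[R]_n) : u != 0 -> 0 < enorm u.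
Proof.
rewrite lt_def enorm_ge0 andbT; apply: contra_neq; exact: enorm_eq0.
Qed.

Lemma enormZ n (a : R) (u : 'rV[R]_n) : enorm (a *: u) = `|a| * enorm u.
Proof.
by rewrite /enorm dotvZl dotvZr mulrA -expr2 sqrtrM ?sqr_ge0 // sqrtr_sqr.
Qed.

Lemma enormN n (u : 'rV[R]_n) : enorm (- u) = enorm u.
Proof. by rewrite -scaleN1r enormZ normrN1 mul1r. Qed.

Lemma enormBC n (u v : 'rV[R]_n) : enorm (u - v) = enorm (v - u).
Proof. by rewrite -enormN opprB. Qed.

Lemma cauchy_schwarz n (u v : 'rV[R]_n) : `|dotv u v| <= enorm u * enorm v.
Proof.
have [->|v0] := eqVneq v 0.
  by rewrite enorm0 mulr0 -(scale0r 0) dotvZr mul0r normr0.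
have vv : 0 < dotv v v by rewrite -sqr_enorm exprn_gt0 // enorm_gt0.
rewrite -(ler_pXn2r (n := 2)) ?nnegrE ?mulr_ge0 ?enorm_ge0 //.
rewrite real_normK ?num_real // exprMn !sqr_enorm -subr_ge0 -(pmulr_rge0 _ vv).
have := dotv_ge0 (dotv v v *: u - dotv u v *: v).
rewrite dotvDl !dotvDr !dotvNl !dotvNr !dotvZl !dotvZr (dotvC v u).
by move=> /le_trans; apply; rewrite le_eqVlt; apply/orP; left; apply/eqP; ring.
Qed.

Lemma dotv_le_enorm n (u v : 'rV[R]_n) : dotv u v <= enorm u * enorm v.
Proof. exact: le_trans (ler_norm _) (cauchy_schwarz _ _). Qed.

Lemma enormD n (u v : 'rV[R]_n) : enorm (u + v) <= enorm u + enorm v.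
Proof.
rewrite -(ler_pXn2r (n := 2)) ?nnegrE ?addr_ge0 ?enorm_ge0 //.
rewrite sqr_enorm sqrrD !sqr_enorm dotvDl !dotvDr (dotvC v u).
by have := dotv_le_enorm u v; lra.
Qed.

Lemma enorm_triangle n (v u w : 'rV[R]_n) :
  enorm (u - w) <= enorm (u - v) + enorm (v - w).
Proof. by apply: le_trans (enormD _ _); rewrite addrA subrK. Qed.

Lemma enorm_le_sub n (v u : 'rV[R]_n) : enorm u <= enorm v + enorm (u - v).
Proof. by apply: le_trans (enormD _ _); rewrite subrKC. Qed.

Lemma enorm_sub_le n (u v : 'rV[R]_n) : `|enorm u - enorm v| <= enorm (u - v).
Proof.
have /= := enormD (u - v) v; have /= := enormD (v - u) u.
rewrite !subrK (enormBC v u) ler_norml => h1 h2.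
by apply/andP; split; lra.
Qed.

Lemma enorm_sum n (I : finType) (f : I -> 'rV[R]_n) :
  enorm (\sum_i f i) <= \sum_i enorm (f i).
Proof.
elim/big_ind2: _ => [|u a v b ua vb|//]; first by rewrite enorm0.
exact: le_trans (enormD _ _) (lerD ua vb).
Qed.

Lemma coord_le_enorm n (u : 'rV[R]_n) i : `|u 0 i| <= enorm u.
Proof.
rewrite -(ler_pXn2r (n := 2)) ?nnegrE ?enorm_ge0 // real_normK ?num_real //.
rewrite sqr_enorm dotvE (bigD1 i) //= -expr2 lerDl.
by rewrite sumr_ge0 // => j _; rewrite -expr2 sqr_ge0.
Qed.

(** The norm on the left is the maximum norm that carries the topology of row vectors; together with
    the next bound it transfers limits and continuity to [enorm]. *)
Lemma norm_le_enorm n (u : 'rV[R]_n) : `|u| <= enorm u.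
Proof.
rewrite /Num.Def.normr /= mx_normrE; apply/bigmax_leP; split => [|[i j] _ /=].
  exact: enorm_ge0.
by rewrite ord1 coord_le_enorm.
Qed.

Lemma enorm_le_norm n (u : 'rV[R]_n) : enorm u <= n%:R * `|u|.
Proof.
have h i : `|u 0 i| <= `|u|.
  by rewrite [leRHS]/Num.Def.normr /= mx_normrE (le_bigmax _ (fun ij => `|u ij.1 ij.2|) (0, i)).
rewrite {1}(row_sum_delta u); apply: le_trans (enorm_sum _) _.
rewrite -[X in X%:R]card_ord -sum1_card natr_sum mulr_suml; apply: ler_sum => i _.
rewrite enormZ (_ : enorm _ = 1) ?mulr1 ?mul1r //.
by rewrite /enorm /dotv trmx_delta mul_delta_mx mxE !eqxx sqrtr1.
Qed.

(** Expanding [h] in the standard basis gives an explicit substitute for the operator norm. *)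
Lemma enorm_linear_le n m (f : {linear 'rV[R]_n -> 'rV[R]_m}) h :
  enorm (f h) <= (\sum_i enorm (f (delta_mx 0 i))) * enorm h.
Proof.
rewrite {1}(row_sum_delta h) linear_sum.
apply: le_trans (enorm_sum _) _; rewrite mulr_suml; apply: ler_sum => i _.
by rewrite linearZ enormZ mulrC ler_wpM2l ?enorm_ge0 ?coord_le_enorm.
Qed.

(** The matrix of an injective map is row free, so it has a right inverse [B]; bounding [B] bounds
    [h] by [f h]. The constant is [(C + 1)^-1] because [C] may be zero. *)
Lemma injective_linear_bound n m (f : {linear 'rV[R]_n -> 'rV[R]_m}) :
  injective f -> exists2 k, 0 < k & forall h, k * enorm h <= enorm (f h).
Proof.
move=> f_inj; have /row_freeP[B AB] : row_free (lin1_mx f).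
  rewrite -kermx_eq0; apply/eqP/row_matrixP => i; rewrite row0; apply: f_inj.
  by rewrite linear0 -mul_rV_lin1 -row_mul mulmx_ker row0.
pose C := \sum_i enorm (mulmxr B (delta_mx 0 i : 'rV_m)).
have C0 : 0 <= C by rewrite sumr_ge0 // => i _; exact: enorm_ge0.
exists (C + 1)^-1 => [|h]; first by rewrite invr_gt0; lra.
rewrite mulrC ler_pdivrMr; last by lra.
have {1}-> : h = mulmxr B (f h) by rewrite /= -mul_rV_lin1 -mulmxA AB mulmx1.
apply: le_trans (enorm_linear_le (mulmxr B) (f h)) _.
by rewrite mulrC ler_wpM2l ?enorm_ge0 //; rewrite /C lerDl.
Qed.

End EuclideanNorm.

(** The codomain [R^o] makes pairing with [w] a linear map between normed modules, so that the chain
    rule applies to it. *)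
Definition dotvr {R : realType} {n : nat} (w u : 'rV[R]_n) : R^o := dotv u w.

Fact dotvr_is_linear (R : realType) (n : nat) (w : 'rV[R]_n) : linear (dotvr w).
Proof. by move=> a u v; rewrite /dotvr dotvDl dotvZl. Qed.

HB.instance Definition _ (R : realType) (n : nat) (w : 'rV[R]_n) :=
  GRing.isLinear.Build R 'rV[R]_n R^o _ (dotvr w) (dotvr_is_linear w).

(** * Differential calculus in the Euclidean norm *)

Section Differential.
Context {R : realType}.
Implicit Types n m : nat.

Lemma nbhs_enorm n (x : 'rV[R]_n) (P : set 'rV[R]_n) :
  nbhs x P -> exists2 d : R, 0 < d & forall z, enorm (z - x) < d -> P z.
Proof.
move=> /nbhs_ballP[d /= d0 dP]; exists d => // z zx; apply: dP.
by rewrite -ball_normE /=; apply: le_lt_trans (norm_le_enorm _) _; rewrite enormBC.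
Qed.

Lemma lipschitz_enorm_continuous n (f : 'rV[R]_n -> R) (C : R) :
  0 <= C -> (forall x y, `|f x - f y| <= C * enorm (x - y)) -> continuous f.
Proof.
move=> C0 lipf x; apply/(@cvgrPdist_lt R R^o _ (nbhs x) (nbhs_filter x)) => e e0.
have K0 : 0 < C * n%:R + 1 by rewrite ltr_wpDl // mulr_ge0.
have := nbhsx_ballx x _ (divr_gt0 e0 K0); rewrite -ball_normE => xb.
near=> y; apply: le_lt_trans (lipf _ _) _.
apply: le_lt_trans (ler_wpM2l C0 (enorm_le_norm _)) _; rewrite mulrA.
have xy : `|x - y| < e / (C * n%:R + 1).
  by near: y; exact: xb.
move: xy; rewrite ltr_pdivlMr // => xy.
by apply: le_lt_trans xy; rewrite mulrC ler_wpM2l // lerDl.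
Unshelve. all: by end_near. Qed.

Lemma enormB_continuous n (y : 'rV[R]_n) : continuous (fun u : 'rV[R]_n => enorm (u - y)).
Proof.
apply: (@lipschitz_enorm_continuous _ _ 1) => // u v.
by rewrite mul1r (le_trans (enorm_sub_le _ _)) // opprB addrA subrK.
Qed.

Lemma dotvr_continuous n (w : 'rV[R]_n) : continuous (dotvr w).
Proof.
apply: (@lipschitz_enorm_continuous _ _ (enorm w)) => [|x y].
  exact: enorm_ge0.
by rewrite /dotvr -dotvNl -dotvDl mulrC cauchy_schwarz.
Qed.

(** Chain rule that reduces the vector-valued [F] to real functions of one variable, ready for the
    mean value theorem and for the derivative test at a minimum. *)
Lemma is_derive_dotv_line n m (F : 'rV[R]_n -> 'rV[R]_m) v h w (t : R) :
  differentiable F (v + t *: h) ->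
  is_derive t 1 (fun s => dotv (F (v + s *: h)) w : R^o)
    (dotv ('d F (v + t *: h) h) w).
Proof.
move=> dF; pose p := fun s : R^o => v + s *: h.
have dp : is_diff t p ( *:%R ^~ h).
  rewrite [p](_ : _ = cst v + *:%R ^~ h); last by [].
  apply: is_diff_eq (is_diffD (is_diff_cst v (t : R^o)) (is_diff_scalel t h)) _.
  by rewrite add0r.
have dFp : is_diff (p t) F ('d F (p t)) by apply: differentiableP.
have dL : is_diff (F (p t)) (dotvr w) (dotvr w).
  apply: DiffDef; first exact/linear_differentiable/dotvr_continuous.
  by rewrite diff_lin //; exact: dotvr_continuous.
have [dG EG] := is_diff_comp dp (is_diff_comp dFp dL).
apply: DeriveDef; first exact: diff_derivable.
by rewrite deriveE // EG /= scale1r.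
Qed.

(** Continuity in each fixed direction becomes uniform in [h] because only the [n] basis directions
    have to be controlled, each up to [eps / n.+1]. *)
Lemma diff_operator_continuous n m (F : 'rV[R]_n -> 'rV[R]_m) x (eps : R) :
  (forall v, {for x, continuous (fun z => 'd F z v)}) -> 0 < eps ->
  exists2 d, 0 < d & forall z h, enorm (z - x) < d ->
    enorm ('d F z h - 'd F x h) <= eps * enorm h.
Proof.
move=> cF e0; pose eps' := eps / n.+1%:R.
have e'0 : 0 < eps' by rewrite divr_gt0.
have [|d d0 dP] := @nbhs_enorm n x (fun z => forall i : 'I_n,
    enorm ('d F z (delta_mx 0 i) - 'd F x (delta_mx 0 i)) < eps').
  apply: (@filter_forall _ _ _ (nbhs x) (nbhs_filter x)) => i.
  have e''0 : 0 < eps' / m.+1%:R by rewrite divr_gt0.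
  have /(@cvgrPdist_lt R 'rV[R]_m _ (nbhs x) (nbhs_filter x)) /(_ _ e''0) :=
    cF (delta_mx 0 i).
  apply: filterS => z; rewrite distrC ltr_pdivlMr ?ltr0n // mulrC => zlt.
  apply: le_lt_trans (enorm_le_norm _) (le_lt_trans _ zlt).
  by rewrite ler_wpM2r // ler_nat.
exists d => // z h zx.
apply: le_trans (enorm_linear_le ('d F z \- 'd F x) h) _.
rewrite ler_wpM2r ?enorm_ge0 //.
apply: (@le_trans _ _ (\sum_(i < n) eps')); first by apply: ler_sum => i _; apply/ltW/dP.
rewrite sumr_const card_ord -mulr_natl /eps' mulrCA ger_pMr // ler_pdivrMr ?ltr0n //.
by rewrite mul1r ler_nat.
Qed.

(** The scalar mean value theorem is applied to the pairing of [F] with the error [w] itself: it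
    turns [|w|^2] into the pairing of [('d F - A) h] with [w], and one factor [|w|] cancels. *)
Lemma mean_value_le n m (F : 'rV[R]_n -> 'rV[R]_m) (A : {linear 'rV[R]_n -> 'rV[R]_m})
    (u v : 'rV[R]_n) (eps : R) :
  (forall t : R, 0 <= t <= 1 -> differentiable F (v + t *: (u - v)) /\
    enorm ('d F (v + t *: (u - v)) (u - v) - A (u - v)) <= eps * enorm (u - v)) ->
  enorm (F u - F v - A (u - v)) <= eps * enorm (u - v).
Proof.
set h := u - v => H; set w := F u - F v - A h.
have dg (t : R) : 0 <= t <= 1 -> is_derive t 1
    (fun s => dotv (F (v + s *: h)) w : R^o) (dotv ('d F (v + t *: h) h) w).
  by move=> /H[dF _]; exact: is_derive_dotv_line.
have [|||t t01] := @MVT R (fun s => dotv (F (v + s *: h)) w)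
    (fun s => dotv ('d F (v + s *: h) h) w) 0 1.
- exact: ltr01.
- by move=> t; rewrite in_itv /= => /andP[/ltW t0 /ltW t1]; apply: dg; rewrite t0.
- apply: continuous_in_subspaceT => t; rewrite inE /= in_itv /= => t01.
  by apply/differentiable_continuous/derivable1_diffP; have [] := dg _ t01.
rewrite subr0 mulr1 scale1r scale0r addr0 {1}/h subrKC => E.
have [|_ Ht] := H t; first by move: t01; rewrite in_itv /= => /andP[/ltW-> /ltW->].
have ww : enorm w ^+ 2 <= eps * enorm h * enorm w.
  rewrite sqr_enorm {1}/w dotvDl dotvDl 2!dotvNl E -dotvNl -dotvDl.
  apply: le_trans (dotv_le_enorm _ _) _.
  by rewrite ler_wpM2r ?enorm_ge0.
have [w0|w0] := eqVneq (enorm w) 0.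
  by rewrite w0; apply: le_trans Ht; exact: enorm_ge0.
by move: ww; rewrite expr2 ler_pM2r // lt_def w0 enorm_ge0.
Qed.

End Differential.

(** * Uniform immersion estimates, critical points of the distance, and the angle condition *)

Section LocalEstimates.
Context {R : realType}.
Implicit Types n m : nat.

Lemma enorm_segment_lt n (x u v : 'rV[R]_n) (d t : R) :
  enorm (u - x) < d -> enorm (v - x) < d -> 0 <= t <= 1 ->
  enorm (v + t *: (u - v) - x) < d.
Proof.
move=> ux vx /andP[t0 t1].
have -> : v + t *: (u - v) - x = t *: (u - x) + (1 - t) *: (v - x).
  by apply/rowP => i; rewrite !mxE; ring.
apply: le_lt_trans (enormD _ _) _; rewrite !enormZ !ger0_norm ?subr_ge0 //.
have [->|tN0] := eqVneq t 0; first by rewrite mul0r add0r subr0 mul1r.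
have {}t0 : 0 < t by rewrite lt_def tN0.
have -> : d = t * d + (1 - t) * d by ring.
by rewrite ltr_leD ?ltr_pM2l // ler_wpM2l ?subr_ge0 // ltW.
Qed.

(** The linearization error is measured against ['d F v] at the moving point [v], since it is needed
    both at the iterates and at the critical points. *)
Definition immersion_on n m (F : 'rV[R]_n -> 'rV[R]_m) x (k L eps d : R) :=
  forall v, enorm (v - x) < d ->
    [/\ differentiable F v,
        forall h, k * enorm h <= enorm ('d F v h) &
        forall u, enorm (u - x) < d ->
        [/\ enorm (F u - F v - 'd F v (u - v)) <= eps * enorm (u - v),
            k * enorm (u - v) <= enorm (F u - F v) &
            enorm (F u - F v) <= L * enorm (u - v)]].

Lemma immersion_onS n m (F : 'rV[R]_n -> 'rV[R]_m) x (k L eps d d' : R) :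
  d' <= d -> immersion_on F x k L eps d -> immersion_on F x k L eps d'.
Proof.
move=> dd' H v vd'; have [dF kF HF] := H v (lt_le_trans vd' dd').
by split=> // u ud'; apply: HF; exact: lt_le_trans dd'.
Qed.

(** [k] and [L] come before [eps], so that [eps] can later be chosen in terms of [k]; only the
    radius depends on [eps]. *)
Lemma immersion_estimates n m (F : 'rV[R]_n -> 'rV[R]_m) x (e : R) :
  0 < e ->
  (forall z, enorm (z - x) < e ->
    differentiable F z /\ forall v, {for z, continuous (fun z => 'd F z v)}) ->
  injective ('d F x) ->
  exists k L : R, 0 < k /\ 0 < L /\ forall eps, 0 < eps ->
    exists2 d, 0 < d & immersion_on F x k L eps d.
Proof.
move=> e0 C1 /injective_linear_bound[k0 k00 k0P].
pose L0 := \sum_i enorm ('d F x (delta_mx 0 i)).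
have L0P h : enorm ('d F x h) <= L0 * enorm h by exact: enorm_linear_le.
have L00 : 0 <= L0 by rewrite sumr_ge0 // => i _; exact: enorm_ge0.
exists (k0 / 2), (L0 + k0); split; first by lra.
split; first by lra.
(* One [eps / 2] pays for the mean value estimate against ['d F x], the other for replacing ['d F x]
   by ['d F v]; the cap [k0 / 2] preserves half of the lower bound [k0]. *)
move=> eps eps0; pose eps1 := Num.min (eps / 2) (k0 / 2).
have e10 : 0 < eps1 by rewrite lt_min; apply/andP; split; lra.
have e1e : eps1 <= eps / 2 by rewrite ge_min lexx.
have e1k : eps1 <= k0 / 2 by rewrite ge_min lexx orbT.
have [|d1 d10 d1P] := @diff_operator_continuous _ _ _ F x eps1 _ e10.
  by apply: (C1 x _).2; rewrite subrr enorm0.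
exists (Num.min d1 e) => [|v]; first by rewrite lt_min d10.
rewrite lt_min => /andP[vd1 ve].
have kk h : k0 * enorm h <= enorm ('d F v h) + eps1 * enorm h.
  apply: le_trans (k0P h) (le_trans (enorm_le_sub ('d F v h) _) _).
  by rewrite lerD2l enormBC d1P.
have ek (h : 'rV[R]_n) : eps1 * enorm h <= k0 / 2 * enorm h by rewrite ler_wpM2r ?enorm_ge0.
split; [exact: (C1 _ ve).1|by move=> h; have := kk h; have := ek h; lra|move=> u].
rewrite lt_min => /andP[ud1 ue].
have sd : enorm (F u - F v - 'd F x (u - v)) <= eps1 * enorm (u - v).
  apply: mean_value_le => t t01; split.
    by apply: (C1 _ _).1; exact: enorm_segment_lt.
  by apply: d1P; exact: enorm_segment_lt.
have := enorm_le_sub (F u - F v) ('d F x (u - v)).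
have := enorm_le_sub ('d F x (u - v)) (F u - F v).
rewrite [X in _ -> _ <= _ + X -> _]enormBC => tri2 tri.
have h4 : enorm ('d F x (u - v) - 'd F v (u - v)) <= eps1 * enorm (u - v).
  by rewrite enormBC; exact: d1P.
have a0 : 0 <= k0 * enorm (u - v) by rewrite mulr_ge0 ?enorm_ge0 // ltW.
split.
- apply: le_trans (enorm_triangle ('d F x (u - v)) _ _) (le_trans (lerD sd h4) _).
  by rewrite -mulrDl ler_wpM2r ?enorm_ge0 //; clear - e1e; lra.
- move: (k0P (u - v)) (ek (u - v)) sd tri.
  move: (enorm (u - v)) (enorm ('d F x _)) (enorm (F u - F v))
    (enorm (F u - F v - _)) => a b c f.
  by clear; lra.
- move: (L0P (u - v)) (ek (u - v)) a0 sd tri2.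
  move: (enorm (u - v)) (enorm ('d F x _)) (enorm (F u - F v))
    (enorm (F u - F v - _)) => a b c f.
  by clear; lra.
Qed.

Lemma enorm_min_closed_ball n m (F : 'rV[R]_n -> 'rV[R]_m) x y (r : R) :
  0 <= r -> (forall z, enorm (z - x) <= r -> {for z, continuous F}) ->
  exists2 x', enorm (x' - x) <= r &
    forall z, enorm (z - x) <= r -> enorm (F x' - y) <= enorm (F z - y).
Proof.
move=> r0 cF; pose B : set 'rV[R]_n := [set z | enorm (z - x) <= r].
have B0 : B !=set0 by exists x; rewrite /B /= subrr enorm0.
have cB : compact B.
  apply: bounded_closed_compact.
    exists (r + enorm x); split; first exact: num_real.
    move=> M rM z /= zB; apply: ltW; apply: le_lt_trans (norm_le_enorm _) _.
    apply: le_lt_trans rM; rewrite -[z](subrK x); apply: le_trans (enormD _ _) _.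
    by rewrite lerD2r.
  have -> : B = (fun z => enorm (z - x)) @^-1` [set t | t <= r] by [].
  by apply: preimage_closed; [move=> z _; exact: enormB_continuous|exact: closed_le].
have [|x' x'B x'min] := @EVT_min_rV R n (fun z => enorm (F z - y)) B B0 cB.
  apply: continuous_in_subspaceT => z; rewrite inE => zB.
  exact: (@continuous_comp _ _ _ F (fun u => enorm (u - y)) z (cF z zB)
    (@enormB_continuous R m y (F z))).
exists x'; first by move: x'B; rewrite inE.
by move=> z zB; apply: x'min; rewrite inE.
Qed.

(** Along a line through [x], the expansion of [|F z - y|^2] has a second-order term that the
    Lipschitz bound makes [O(t^2)], so the first-order term must vanish at a minimum. *)
Lemma enorm_min_critical n m (F : 'rV[R]_n -> 'rV[R]_m) x y (r L : R) :
  0 < r -> 0 <= L ->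
  (forall z, enorm (z - x) < r -> [/\ differentiable F z,
     enorm (F z - F x) <= L * enorm (z - x) & enorm (F x - y) <= enorm (F z - y)]) ->
  forall u, dotv ('d F x u) (y - F x) = 0.
Proof.
move=> r0 L0 H u; pose b := F x - y; pose K := (L * enorm u) ^+ 2.
have U0 : 0 < enorm u + 1 by rewrite ltr_wpDl ?enorm_ge0.
pose a := r / (enorm u + 1); have a0 : 0 < a by rewrite divr_gt0.
have inb (t : R) : `|t| < a -> enorm (x + t *: u - x) < r.
  rewrite addrC addKr enormZ ltr_pdivlMr // => ta; apply: le_lt_trans ta.
  by rewrite ler_wpM2l // lerDl.
pose g (s : R) : R^o := dotv (F (x + s *: u)) b.
(* Up to a constant, [p] majorizes the squared distance to [y] along the line and agrees with it at
   [0]. Hence [p] is also minimal at [0], and differentiating it involves only a linear pairing of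
   [F]. *)
pose p : R -> R^o := 2 \*: g + K \*: (id ^+ 2).
have dg (t : R) : `|t| < a -> is_derive t 1 g (dotv ('d F (x + t *: u) u) b).
  by move=> /inb/H[dF _ _]; exact: is_derive_dotv_line.
have dp (t : R) : `|t| < a ->
    is_derive t 1 p (2 * dotv ('d F (x + t *: u) u) b + K * (2 * t)).
  move=> /dg dgt; apply: is_derive_eq (is_deriveD (is_deriveZ 2 dgt)
    (is_deriveZ K (is_deriveX 2 (is_derive_id (t : R^o) 1)))) _.
  by rewrite /GRing.scale /= expr1 mulr1.
have pE t : p t = 2 * dotv (F (x + t *: u)) b + K * t ^+ 2 by [].
have p0 : is_derive (0 : R) 1 p 0.
  apply: (@derive1_at_min _ _ (- a) a).
  - by lra.
  - by move=> t; rewrite in_itv /= -ltr_norml => /dp[].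
  - by rewrite in_itv /= oppr_lt0 a0.
  - move=> t; rewrite in_itv /= -ltr_norml => /inb/H[_ lip mn].
    rewrite !pE expr0n mulr0 addr0 scale0r addr0.
    have : enorm (F (x + t *: u) - F x) ^+ 2 <= K * t ^+ 2.
      rewrite /K -exprMn -(real_normK (num_real (_ * t))).
      rewrite ler_pXn2r ?nnegrE ?enorm_ge0 // !normrM (ger0_norm L0).
      rewrite (ger0_norm (enorm_ge0 u)) mulrAC -mulrA -enormZ.
      by move: lip; rewrite [x + _ - x]addrC addKr.
    move: mn; rewrite -(ler_pXn2r (n := 2)) ?nnegrE ?enorm_ge0 // !sqr_enorm.
    set d := F (x + t *: u) - F x.
    have -> : F (x + t *: u) - y = d + b by rewrite addrA subrK.
    have -> : dotv (F (x + t *: u)) b = dotv d b + dotv (F x) b.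
      by rewrite -dotvDl subrK.
    rewrite -/b (dotvDl d b) !(dotvDr d b) (dotvC b d).
    move: (dotv d d) (dotv b b) (dotv d b) (dotv (F x) b) (K * _) => *.
    by lra.
have := dp 0; rewrite normr0 => /(_ a0) [_].
have [_ ->] := p0; rewrite scale0r addr0 !mulr0 addr0 => E.
by rewrite -opprB dotvNr -/b; lra.
Qed.

Lemma angle_cos_bound (alpha : R) : 0 < alpha ->
  exists2 c : R, 0 <= c < 1 & forall n (u v : 'rV[R]_n), u != 0 -> v != 0 ->
    (* Truncation at [pi / 2] makes [cos b] nonnegative and keeps [b] in the interval where the
       cosine decreases. *)
    alpha <= angle u v -> dotv u v <= c * (enorm u * enorm v).
Proof.
move=> a0; pose b := Num.min alpha (pi / 2).
have pi0 : 0 < pi :> R by exact: pi_gt0.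
have b0 : 0 < b by rewrite lt_min a0 divr_gt0.
have bpi : b <= pi / 2 by rewrite ge_min lexx orbT.
have bI : b \in `[0, pi] by rewrite in_itv /= ltW //=; lra.
exists (cos b).
  apply/andP; split; first by rewrite cos_ge0_pihalf // bpi andbT; lra.
  by rewrite -cos0 ltr_cos // in_itv /= lexx ltW.
move=> n u v u0 v0 auv.
have uv0 : 0 < enorm u * enorm v by rewrite mulr_gt0 ?enorm_gt0.
have tI : -1 <= dotv u v / (enorm u * enorm v) <= 1.
  rewrite -ler_norml normrM normfV (gtr0_norm uv0) ler_pdivrMr // mul1r.
  exact: cauchy_schwarz.
rewrite -ler_pdivrMr // -[leLHS]acosK; last by rewrite in_itv.
rewrite -/(angle u v) leNgt ltr_cos //; last first.
  by rewrite in_itv /= /angle acos_ge0 ?acos_lepi.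
by rewrite -leNgt; apply: le_trans auv; rewrite ge_min lexx.
Qed.

End LocalEstimates.

(** * One step of the method contracts the distance to [Q] *)

Section Contraction.
Context {R : realType} {n m : nat}.
Variables (F : 'rV[R]_n -> 'rV[R]_m) (Q : set 'rV[R]_m) (xbar : 'rV[R]_n).
Variables (k L eps d : R).
Hypotheses (k0 : 0 < k) (L0 : 0 < L) (eps0 : 0 < eps) (d0 : 0 < d).
Hypothesis immF : immersion_on F xbar k L eps d.

(** Radius allowed for the iterates: the term [8 * L] makes the minimizer [x'] interior to the ball
    of radius [d / 2], and [2 * k] gives [r1 <= d / 2]; together they keep [x + s] within [d]. *)
Let r1 := d * k / (8 * L + 2 * k).

Let r1P x : enorm (x - xbar) < r1 ->
  8 * L * enorm (x - xbar) + 2 * k * enorm (x - xbar) < d * k.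
Proof.
by rewrite ltr_pdivlMr ?addr_gt0 ?mulr_gt0 // => h; rewrite -mulrDl mulrC.
Qed.

Let r1_half x : enorm (x - xbar) < r1 -> enorm (x - xbar) < d / 2.
Proof.
move=> /r1P; move: (enorm _) (enorm_ge0 (x - xbar)) => a a0 h.
have La : 0 <= L * a by rewrite mulr_ge0 // ltW.
by rewrite -(ltr_pM2l k0); lra.
Qed.

Let d2 : d / 2 < d. Proof. by rewrite ltr_pdivrMr // ltr_pMr // ltr1n. Qed.

Let d20 : 0 <= d / 2. Proof. by rewrite divr_ge0 // ltW. Qed.

Let xbar_in : enorm (xbar - xbar) < d.
Proof. by rewrite subrr enorm0. Qed.

(** Taking [xbar] as competitor gives [k |x' - xbar| <= 2 |F xbar - y| <= 4 L |x - xbar| < d k / 2],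
    so the minimizer over the closed ball of radius [d / 2] is not on its boundary. *)
Lemma near_critical_point x y : enorm (x - xbar) < r1 ->
  enorm (F xbar - y) <= 2 * L * enorm (x - xbar) ->
  exists x', [/\ enorm (x' - xbar) < d,
    forall u, dotv ('d F x' u) (y - F x') = 0 &
    enorm (F x' - y) <= enorm (F x - y)].
Proof.
move=> xr1 Fy; have xh := r1_half xr1.
have half z : enorm (z - xbar) <= d / 2 -> enorm (z - xbar) < d.
  by move/le_lt_trans; apply.
have [||x' x'd x'min] := @enorm_min_closed_ball _ _ _ F xbar y (d / 2).
- exact: d20.
- by move=> z /half/immF[dF _ _]; exact: differentiable_continuous.
have [_ _ /(_ _ (half _ x'd))[_ kx' _]] := immF xbar_in.
have x'lt : enorm (x' - xbar) < d / 2.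
  have h1 := x'min xbar; rewrite subrr enorm0 in h1.
  have {}h1 := h1 d20.
  have h2 := enorm_triangle y (F x') (F xbar).
  rewrite (enormBC y) in h2.
  rewrite -(ltr_pM2l k0).
  move: (r1P xr1) (enorm_ge0 (x - xbar)) kx' h1 h2 Fy.
  move: (enorm (x - xbar)) (enorm (x' - xbar)) (enorm (F x' - F xbar))
    (enorm (F x' - y)) (enorm (F xbar - y)) => a b c e f h1 a0 *.
  have : 0 <= k * a by rewrite mulr_ge0 // ltW.
  by lra.
exists x'; split; [exact: half| |exact/x'min/ltW].
apply: (@enorm_min_critical _ _ _ F x' y (d / 2 - enorm (x' - xbar)) L).
- by rewrite subr_gt0.
- exact: ltW.
move=> z zx'.
have zd : enorm (z - xbar) <= d / 2.
  apply: le_trans (enorm_triangle x' _ _) _.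
  by move: zx' => /ltW; rewrite lerBrDr.
have [dF _ _] := immF (half _ zd).
have [_ _ /(_ _ (half _ zd))[_ _ Lz]] := immF (half _ x'd).
by split=> //; exact: x'min.
Qed.

(** Write [F x' - y] as [(F x - y) - 'd F x' (x - x') - e]. Pairing with [F x' - y] kills the middle
    term by criticality, the angle bounds the first, and [k |x - x'| <= 2 |F x - y|] bounds the
    error by the [2 * eps] term. *)
Lemma angle_contraction x x' y (c : R) : 0 <= c ->
  enorm (x - xbar) < d -> enorm (x' - xbar) < d ->
  (forall u, dotv ('d F x' u) (y - F x') = 0) ->
  enorm (F x' - y) <= enorm (F x - y) ->
  dotv (F x - y) (F x' - y) <= c * (enorm (F x - y) * enorm (F x' - y)) ->
  k * enorm (F x' - y) <= (k * c + 2 * eps) * enorm (F x - y).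
Proof.
move=> c0 xd x'd crit ba ang.
have [_ _ /(_ _ xd)[lin low _]] := immF x'd.
pose e := F x - F x' - 'd F x' (x - x').
have E : enorm (F x' - y) ^+ 2 = dotv (F x - y) (F x' - y) - dotv e (F x' - y).
  have /eqP := crit (x - x').
  rewrite -(opprB (F x') y) dotvNr oppr_eq0 => /eqP crit0.
  rewrite sqr_enorm -dotvNl -dotvDl -[RHS]subr0 -crit0 -dotvNl -dotvDl.
  congr (dotv _ _); rewrite /e; move: ('d F x' (x - x')) => w.
  by apply/rowP => i; rewrite !mxE; ring.
have low2 : k * enorm (x - x') <= 2 * enorm (F x - y).
  apply: le_trans low _; apply: le_trans (enorm_triangle y _ _) _.
  by rewrite (enormBC y) mulr_natl mulr2n lerD2l.
have eb : - dotv e (F x' - y) <= eps * enorm (x - x') * enorm (F x' - y).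
  rewrite -dotvNl; apply: le_trans (dotv_le_enorm _ _) _.
  by rewrite enormN ler_wpM2r ?enorm_ge0.
move: E ang low2 eb; have := enorm_ge0 (F x' - y); have := enorm_ge0 (F x - y).
move: (dotv e _) (dotv _ _) (enorm (F x' - y)) (enorm (F x - y)) (enorm (x - x')).
move=> p q b a s a0 b0 E ang low2 eb.
have [->|bN0] := eqVneq b 0.
  by rewrite mulr0 mulr_ge0 // addr_ge0 // mulr_ge0 // ltW.
have bp : 0 < b by rewrite lt_def bN0.
rewrite -(ler_pM2r bp).
have h1 : b ^+ 2 <= c * (a * b) + eps * s * b by rewrite E; exact: lerD.
have h2 : eps * b * (k * s) <= eps * b * (2 * a).
  by rewrite ler_wpM2l // mulr_ge0 // ltW.
have h3 : k * b ^+ 2 <= k * (c * (a * b) + eps * s * b) by rewrite ler_wpM2l // ltW.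
apply: le_trans (_ : k * (c * (a * b) + eps * s * b) <= _).
  by apply: le_trans h3; rewrite expr2 mulrA.
have -> : k * (c * (a * b) + eps * s * b) = k * c * a * b + eps * b * (k * s) by ring.
have -> : (k * c + 2 * eps) * a * b = k * c * a * b + eps * b * (2 * a) by ring.
by rewrite lerD2l.
Qed.

Hypothesis QFxbar : Q (F xbar).
Variable c : R.
Hypothesis c0 : 0 <= c.
Hypothesis angleQ : forall x x' y, enorm (x - xbar) < d -> enorm (x' - xbar) < d ->
  proj_set Q (F x) y -> (forall u, dotv ('d F x' u) (y - F x') = 0) ->
  F x <> y -> y <> F x' ->
  dotv (F x - y) (F x' - y) <= c * (enorm (F x - y) * enorm (F x' - y)).

(** A point [q] of [Q] within [t] of [F x] stands for the distance to [Q] being at most [t]; in this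
    form the bound can be iterated with [t] a geometric sequence. *)
Lemma lap_step_contraction x x1 (t : R) : enorm (x - xbar) < r1 ->
  lap_step F Q x x1 -> (exists2 q, Q q & enorm (F x - q) <= t) ->
  enorm (x1 - x) <= 2 / k * t /\
  exists2 q, Q q & enorm (F x1 - q) <= (c + 6 * eps / k) * t.
Proof.
move=> xr1 [stop go] [q Qq qt].
have t0 : 0 <= t by apply: le_trans qt; exact: enorm_ge0.
have C0 : 0 <= c + 6 * eps / k by rewrite addr_ge0 // divr_ge0 ?mulr_ge0 // ltW.
have [QFx|nQFx] := pselect (Q (F x)).
  rewrite stop // subrr enorm0; split; first by rewrite mulr_ge0 // divr_ge0 // ltW.
  by exists (F x) => //; rewrite subrr enorm0 mulr_ge0.
have [y [yproj [s [-> smin]]]] := go nQFx.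
have [Qy ymin] := yproj; rewrite [x + s - x]addrC addKr.
have at_ : enorm (F x - y) <= t by apply: le_trans qt; exact: ymin.
have xd2 := r1_half xr1.
have xd : enorm (x - xbar) < d by apply: lt_trans xd2 _.
have [_ _ /(_ _ xd)[_ _ Lx]] := immF xbar_in.
have aL : enorm (F x - y) <= L * enorm (x - xbar).
  by apply: le_trans Lx; exact: ymin.
have Fxbar_y : enorm (F xbar - y) <= 2 * L * enorm (x - xbar).
  apply: le_trans (enorm_triangle (F x) _ _) _; rewrite (enormBC (F xbar)).
  by apply: le_trans (lerD Lx aL) _; rewrite -mulrDl [2 * L]mulr_natl mulr2n.
have [x' [x'd crit ba]] := near_critical_point xr1 Fxbar_y.
have ang : dotv (F x - y) (F x' - y) <= c * (enorm (F x - y) * enorm (F x' - y)).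
  (* The angle condition says nothing when [y = F x'], but then both sides are zero. *)
  have [yx'|yx'] := pselect (y = F x').
    by rewrite -yx' subrr enorm0 mulr0 mulr0 -(scale0r 0) dotvZr mul0r.
  by apply: angleQ => // Fxy; apply: nQFx; rewrite Fxy.
have bkc := angle_contraction c0 xd x'd crit ba ang.
have [_ kD linx] := immF xd.
(* The zero step is a competitor of [s], so the linearized residual is at most [|F x - y|]. *)
have ks : k * enorm s <= 2 * enorm (F x - y).
  apply: le_trans (kD s) _; have := smin 0; rewrite linear0 addr0 => s0.
  have -> : 'd F x s = (F x + 'd F x s - y) - (F x - y).
    by move: ('d F x s) => w; apply/rowP => i; rewrite !mxE; ring.
  apply: le_trans (enormD _ _) _; rewrite enormN.
  by rewrite mulr_natl mulr2n lerD2r.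
have sxd : enorm (x + s - xbar) < d.
  apply: le_lt_trans (enorm_triangle x _ _) _; rewrite [x + s - x]addrC addKr.
  rewrite -(ltr_pM2l k0) mulrDr [ltRHS]mulrC.
  apply: le_lt_trans (r1P xr1).
  have : 0 <= L * enorm (x - xbar) by rewrite mulr_ge0 ?enorm_ge0 // ltW.
  have : 0 <= k * enorm (x - xbar) by rewrite mulr_ge0 ?enorm_ge0 // ltW.
  move: ks aL; move: (enorm s) (enorm (x - xbar)) (enorm (F x - y)).
  by move=> *; lra.
split.
  rewrite mulrAC ler_pdivlMr // mulrC; apply: le_trans ks _.
  by rewrite ler_pM2l.
exists y => //.
have [lin1 _ _] := linx _ sxd.
rewrite [x + s - x]addrC addKr in lin1.
have [lin2 low2 _] := linx _ x'd.
have tan : enorm (F x + 'd F x s - y) <= enorm (F x' - y) + eps * enorm (x' - x).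
  apply: le_trans (smin (x' - x)) _.
  have -> : F x + 'd F x (x' - x) - y =
      (F x' - y) - (F x' - F x - 'd F x (x' - x)).
    by move: ('d F x _) => w; apply/rowP => i; rewrite !mxE; ring.
  by apply: le_trans (enormD _ _) _; rewrite enormN lerD2l.
have fin : enorm (F (x + s) - y) <= eps * enorm s + enorm (F x + 'd F x s - y).
  have -> : F (x + s) - y = (F (x + s) - F x - 'd F x s) + (F x + 'd F x s - y).
    by move: ('d F x _) => w; apply/rowP => i; rewrite !mxE; ring.
  by apply: le_trans (enormD _ _) _; rewrite lerD2r.
have low3 : k * enorm (x' - x) <= 2 * enorm (F x - y).
  apply: le_trans low2 _; apply: le_trans (enorm_triangle y _ _) _.
  by rewrite (enormBC y) mulr_natl mulr2n lerD2r.
apply: le_trans (_ : (c + 6 * eps / k) * enorm (F x - y) <= _); last first.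
  by rewrite ler_wpM2l.
have e1 : eps * (k * enorm s) <= eps * (2 * enorm (F x - y)).
  by rewrite ler_wpM2l // ltW.
have e2 : eps * (k * enorm (x' - x)) <= eps * (2 * enorm (F x - y)).
  by rewrite ler_wpM2l // ltW.
rewrite -(ler_pM2l k0).
(* The [6] collects three errors of size [2 * eps]: the angle estimate at [x'], the linearization at
   [x'], and the linearization at [x + s]. *)
have -> : k * ((c + 6 * eps / k) * enorm (F x - y)) =
    (k * c + 2 * eps) * enorm (F x - y) + 2 * (eps * (2 * enorm (F x - y))).
  by move: (enorm _) => a; field; rewrite gt_eqF.
apply: le_trans (ler_wpM2l (ltW k0) (le_trans fin (lerD (lexx _) tan))) _.
move: bkc e1 e2; move: (enorm (F x - y)) (enorm s) (enorm (x' - x)) (enorm (F x' - y)).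
by move=> *; lra.
Qed.

End Contraction.

(** * Sequences with geometrically decreasing steps *)

Section GeometricConvergence.
Context {R : realType} {n : nat}.
Variables (xs : nat -> 'rV[R]_n) (B c : R).
Hypotheses (B0 : 0 <= B) (c01 : 0 < c < 1).

(** Keeping the exact partial sum, with its factor [1 - c ^+ j], lets the induction close. Only
    steps before [k + j] are assumed, so the bound is usable while the step bounds are still being
    established. *)
Lemma geometric_dist k j :
  (forall i, (i < k + j)%N -> enorm (xs i.+1 - xs i) <= B * c ^+ i) ->
  enorm (xs (k + j) - xs k) <= B / (1 - c) * c ^+ k * (1 - c ^+ j).
Proof.
have /andP[_ c1] := c01.
elim: j => [|j IH] H.
  by rewrite addn0 subrr enorm0 expr0 subrr mulr0.
apply: le_trans (enorm_triangle (xs (k + j)) _ _) _.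
have h1 := H (k + j)%N; rewrite addnS in h1 H *.
have {}h1 := h1 (leqnn _).
have h2 := IH (fun i ik => H i (ltnW ik)).
apply: le_trans (lerD h1 h2) _; rewrite exprD exprS.
rewrite le_eqVlt; apply/orP; left; apply/eqP; field.
by rewrite subr_eq0 gt_eqF.
Qed.

Lemma geometric_dist_le k j :
  (forall i, (i < k + j)%N -> enorm (xs i.+1 - xs i) <= B * c ^+ i) ->
  enorm (xs (k + j) - xs k) <= B / (1 - c) * c ^+ k.
Proof.
have /andP[c0 c1] := c01.
move/geometric_dist/le_trans; apply; rewrite ler_piMr //.
  by rewrite mulr_ge0 ?exprn_ge0 ?divr_ge0 ?subr_ge0 // ltW.
by rewrite gerBl exprn_ge0 // ltW.
Qed.

Lemma geometric_small (M e : R) : 0 < e -> exists k : nat, M * c ^+ k < e.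
Proof.
move=> e0; have /andP[c0 c1] := c01.
have M0 : 0 < `|M| + 1 by rewrite ltr_wpDl.
have c1' : `|c| < 1 by rewrite gtr0_norm.
have /cvgrPdist_lt /(_ _ (divr_gt0 e0 M0)) [N _ /(_ N (leqnn N))] := cvg_expr c1'.
rewrite /= sub0r normrN ger0_norm ?exprn_ge0 ?(ltW c0) // => cN; exists N.
apply: le_lt_trans (_ : (`|M| + 1) * c ^+ N < e); last by rewrite mulrC -ltr_pdivlMr.
rewrite ler_wpM2r ?exprn_ge0 ?(ltW c0) //.
by apply: le_trans (ler_norm _) _; rewrite lerDl.
Qed.

Lemma geometric_limit :
  (forall i, enorm (xs i.+1 - xs i) <= B * c ^+ i) ->
  exists xh, forall k, enorm (xs k - xh) <= B / (1 - c) * c ^+ k.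
Proof.
move=> H; have dist k j : enorm (xs (k + j) - xs k) <= B / (1 - c) * c ^+ k.
  by apply: geometric_dist_le => i _; exact: H.
have : cauchy (xs @ \oo).
  apply: cauchy_exP => e e0.
  have [k ke] := geometric_small (B / (1 - c)) e0.
  exists (xs k); exists k => // j /= kj.
  rewrite -ball_normE /=; apply: le_lt_trans (norm_le_enorm _) _.
  by rewrite enormBC -(subnKC kj); exact: le_lt_trans (dist _ _) ke.
move=> /cauchy_cvg/cvg_ex[xh xsxh]; exists xh => k.
apply/ler_addgt0Pr => e e0.
have e'0 : 0 < e / n.+1%:R by rewrite divr_gt0.
have /cvgrPdist_lt /(_ _ e'0) [N _ NP] := xsxh.
(* The index [k + N] is late enough to be close to the limit and lies in the tail from [k]. *)
have {}NP := NP (k + N)%N (leq_addl _ _).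
apply: le_trans (enorm_triangle (xs (k + N)) _ _) _.
rewrite enormBC lerD // enormBC; apply: le_trans (enorm_le_norm _) _.
move: NP; rewrite /= ltr_pdivlMr ?ltr0n // => NP.
by apply: le_trans (ltW NP); rewrite mulrC ler_wpM2l // ler_nat.
Qed.

End GeometricConvergence.

(** * Linear convergence of the iterates to a point of the solution set *)

Theorem mainTheorem4 (R : realType) (n m : nat)
  (Q : set 'rV[R]_m) (F : 'rV[R]_n -> 'rV[R]_m) (xbar : 'rV[R]_n) :
  closed Q -> Q !=set0 ->
  (* F is C^1 around xbar *)
  (exists e : R, 0 < e /\ forall x, enorm (x - xbar) < e ->
      differentiable F x /\
      forall v, {for x, continuous (fun z => 'd F z v)}) ->
  (* DF(xbar) is one-to-one *)
  injective ('d F xbar) ->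
  Q (F xbar) ->
  (* angle condition *)
  (exists alpha : R, 0 < alpha /\ exists delta : R, 0 < delta /\
     forall x x' y, enorm (x - xbar) < delta -> enorm (x' - xbar) < delta ->
       proj_set Q (F x) y ->
       (forall u, dotv ('d F x' u) (y - F x') = 0) ->
       F x <> y -> y <> F x' ->
       alpha <= angle (F x - y) (F x' - y)) ->
  exists r : R, 0 < r /\
    forall xs : nat -> 'rV[R]_n, enorm (xs 0%N - xbar) < r ->
      (forall k, lap_step F Q (xs k) (xs k.+1)) ->
      exists xh, Q (F xh) /\ lin_conv xs xh.
Proof.
move=> clQ _ [e [e0 C1]] injD QFxbar [alpha [alpha0 [delta [delta0 angQ]]]].
have [ca /andP[ca0 ca1] caP] := angle_cos_bound alpha0.
(* This [eps] makes the contraction factor [ca + 6 * eps / k] equal to [(1 + ca) / 2], the midpoint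
   between [ca] and [1]. *)
have [k [L [k0 [L0 /(_ (k * (1 - ca) / 12))]]]] := immersion_estimates e0 C1 injD.
set eps := k * (1 - ca) / 12 => immF.
have eps0 : 0 < eps by rewrite divr_gt0 // mulr_gt0 // subr_gt0.
have {immF} [d1 d10 immF1] := immF eps0.
pose d := Num.min d1 delta.
have d0 : 0 < d by rewrite lt_min d10.
have dd1 : d <= d1 by rewrite ge_min lexx.
have ddelta : d <= delta by rewrite ge_min lexx orbT.
have immF := immersion_onS dd1 immF1.
have angd x x' y : enorm (x - xbar) < d -> enorm (x' - xbar) < d ->
    proj_set Q (F x) y -> (forall u, dotv ('d F x' u) (y - F x') = 0) ->
    F x <> y -> y <> F x' ->
    dotv (F x - y) (F x' - y) <= ca * (enorm (F x - y) * enorm (F x' - y)).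
  move=> xd x'd yP crit xy yx'; apply: caP.
  - by rewrite subr_eq0; exact/eqP.
  - by rewrite subr_eq0 eq_sym; exact/eqP.
  - by apply: angQ => //; exact: lt_le_trans ddelta.
have step := lap_step_contraction k0 L0 eps0 d0 immF QFxbar ca0 angd.
pose c := ca + 6 * eps / k.
have cE : c = (1 + ca) / 2 by rewrite /c /eps; field; rewrite gt_eqF.
have c01 : 0 < c < 1 by rewrite cE; apply/andP; split; lra.
have /andP[c0 c1] := c01; have oc0 : 0 < 1 - c by rewrite subr_gt0.
pose r1 := d * k / (8 * L + 2 * k).
have den0 : 0 < 8 * L + 2 * k by rewrite addr_gt0 // mulr_gt0.
have r10 : 0 < r1 by rewrite divr_gt0 // mulr_gt0.
have r1d : r1 <= d.
  by rewrite ler_pdivrMr // ler_pM2l //; clear - k0 L0; lra.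
(* All steps together move the iterate by at most [2 / k * t0 / (1 - c)], where
   [t0 <= L |xs 0 - xbar|]. Starting within [r1 / A] therefore keeps every iterate within [r1]. *)
pose A := 1 + 2 / k * L / (1 - c).
have A0 : 0 < A by rewrite ltr_pwDl // !(mulr_ge0, invr_ge0) // ltW.
exists (r1 / A); split; first by rewrite divr_gt0.
move=> xs xs0 lap; pose t0 := enorm (F (xs 0%N) - F xbar).
have xbar_in : enorm (xbar - xbar) < d by rewrite subrr enorm0.
have A1 : 1 <= A by rewrite lerDl !(mulr_ge0, invr_ge0) // ltW.
have xs0d : enorm (xs 0%N - xbar) < d.
  apply: lt_le_trans xs0 (le_trans _ r1d); rewrite ler_pdivrMr //.
  by rewrite ler_peMr // ltW.
have t0L : t0 <= L * enorm (xs 0%N - xbar).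
  by have [_ _ /(_ _ xs0d)[]] := immF _ xbar_in.
have t00 : 0 <= t0 by exact: enorm_ge0.
pose B := 2 / k * t0.
have B0 : 0 <= B by rewrite mulr_ge0 // divr_ge0 // ltW.
have near_r1 z : enorm (z - xs 0%N) <= B / (1 - c) -> enorm (z - xbar) < r1.
  move=> zx; apply: le_lt_trans (enorm_triangle (xs 0%N) _ _) _.
  move: xs0; rewrite ltr_pdivlMr // => /(le_lt_trans _); apply.
  rewrite mulrDr mulr1 addrC lerD2l; apply: le_trans zx _.
  have -> : enorm (xs 0%N - xbar) * (2 / k * L / (1 - c)) =
      2 / k * (L * enorm (xs 0%N - xbar)) / (1 - c) by ring.
  rewrite ler_wpM2r ?invr_ge0 ?(ltW oc0) // ler_wpM2l //.
  by rewrite divr_ge0 // ltW.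
(* Both bounds go through one induction: the earlier step bounds keep [xs j] within [r1], and this
   allows the contraction to be applied once more. *)
have inv j : (forall i, (i < j)%N -> enorm (xs i.+1 - xs i) <= B * c ^+ i) /\
    exists2 q, Q q & enorm (F (xs j) - q) <= t0 * c ^+ j.
  elim: j => [|j [IH1 IH2]].
    by split=> //; exists (F xbar) => //; rewrite expr0 mulr1.
  have xj : enorm (xs j - xbar) < r1.
    apply: near_r1; have := @geometric_dist_le _ _ xs B c B0 c01 0 j IH1.
    by rewrite expr0 mulr1.
  have [sj [q Qq qj]] := step _ _ _ xj (lap j) IH2.
  split; last by exists q => //; rewrite exprS mulrCA.
  move=> i; rewrite ltnS leq_eqVlt => /orP[/eqP->|/IH1//].
  by rewrite /B -mulrA.
have stepB i : enorm (xs i.+1 - xs i) <= B * c ^+ i.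
  by have [/(_ i (leqnn _))] := inv i.+1.
have [xh xhP] := geometric_limit B0 c01 stepB.
exists xh; split; last first.
  (* The added [1] gives the strict inequality and a positive constant even when [B = 0]. *)
  exists c, (B / (1 - c) + 1); split=> //; split.
    by rewrite ltr_wpDl // divr_ge0 // ltW.
  move=> j; apply: le_lt_trans (xhP j) _.
  by rewrite ltr_pM2r ?exprn_gt0 // ltrDl.
have xhd : enorm (xh - xbar) < d.
  apply: lt_le_trans r1d; apply: near_r1; rewrite enormBC.
  by have := xhP 0%N; rewrite expr0 mulr1.
(* [F xh] is a limit of points of [Q]: some [q] in [Q] lies within [L |xs j - xh| + t0 * c ^+ j] of
   it, and this tends to zero. *)
apply: clQ => U /nbhs_enorm[e1 e10 e1U].
have [j jlt] := geometric_small c01 (L * (B / (1 - c)) + t0) e10.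
have [_ [q Qq qj]] := inv j; exists q; split=> //; apply: e1U.
apply: le_lt_trans jlt; rewrite mulrDl.
apply: le_trans (enorm_triangle (F (xs j)) _ _) _; rewrite addrC lerD //.
  have xjd : enorm (xs j - xbar) < d.
    apply: lt_le_trans r1d; apply: near_r1.
    have := @geometric_dist_le _ _ xs B c B0 c01 0 j (fun i _ => stepB i).
    by rewrite expr0 mulr1.
  have [_ _ /(_ _ xjd)[_ _ Lj]] := immF _ xhd.
  by apply: le_trans Lj _; rewrite -mulrA ler_pM2l.
by rewrite enormBC.
Qed.
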